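(* Let $p$ be a prime and let $G$ be a $p$-group that has exponent $p$ and satisfies $|G| \le p^{2+p/2}$. Then every irreducible representation of $G$ does phase retrieval.
   Context: A $p$-group is a finite group of order $p^s$ with $s>0$, $p$ prime. The exponent of a finite group $G$ is the smallest positive integer $n$ with $x^n=e$ for all $x\in G$. All representations are unitary. For a unitary representation $\pi$ of a finite group $G$ on $\mathcal{H}_\pi$ and $\eta,f\in\mathcal{H}_\pi$ put $V_\eta f(x) = \langle f,\pi(x)\eta\rangle$, $x \in G$. A vector $\eta$ does phase retrieval for $\pi$ if for all $f,g\in\mathcal{H}_\pi$, $|V_\eta f| = |V_\eta g|$ on $G$ implies $f = c\,g$ for some $c\in\mathbb{C}$ with $|c|=1$; $\pi$ does phase retrieval if some $\eta\in\mathcal{H}_\pi$ does. *)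

(* Defs.v *)
From mathcomp Require Import all_boot all_order all_fingroup all_algebra.
From mathcomp Require Import all_solvable all_character.
From mathcomp Require Import complex.
From mathcomp Require Import reals exp.

Set Implicit Arguments.
Unset Strict Implicit.
Unset Printing Implicit Defensive.

Import Order.TTheory GRing.Theory Num.Theory.
Local Open Scope ring_scope.

(* H_pi is 'rV_n with its standard Hermitian inner product [dotmx], linear in
   its first argument. *)
Definition unitary_repr (C : numClosedFieldType) (gT : finGroupType)
    (G : {group gT}) (n : nat) (rG : mx_representation C G n) : Prop :=
  forall x, x \in G -> rG x \is unitarymx.

(* V_eta f (x) = <f, pi(x) eta>, where pi(x) is v |-> v *m rG x: like
   [mxmodule] and [mx_irreducible], this uses the right action on row vectors.
   The left action v |-> v *m rG x^-1 gives the same function up to the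
   bijection x |-> x^-1 of G. *)
Definition coef_transform (C : numClosedFieldType) (gT : finGroupType)
    (G : {group gT}) (n : nat) (rG : mx_representation C G n)
    (eta f : 'rV[C]_n) (x : gT) : C :=
  dotmx f (eta *m rG x).

Definition vector_does_phase_retrieval (C : numClosedFieldType)
    (gT : finGroupType) (G : {group gT}) (n : nat)
    (rG : mx_representation C G n) (eta : 'rV[C]_n) : Prop :=
  forall f g : 'rV[C]_n,
    (forall x, x \in G ->
       `|coef_transform rG eta f x| = `|coef_transform rG eta g x|) ->
    exists c : C, `|c| = 1 /\ f = c *: g.

Definition does_phase_retrieval (C : numClosedFieldType) (gT : finGroupType)
    (G : {group gT}) (n : nat) (rG : mx_representation C G n) : Prop :=
  exists eta : 'rV[C]_n, vector_does_phase_retrieval rG eta.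

(* Main.v *)
Require Import Defs.
From mathcomp Require Import all_boot all_order all_fingroup all_algebra.
From mathcomp Require Import all_solvable all_character.
From mathcomp Require Import complex.
From mathcomp Require Import reals exp.
From mathcomp Require Import zify ring lra.

Set Implicit Arguments.
Unset Strict Implicit.
Unset Printing Implicit Defensive.

Import Order.TTheory GRing.Theory Num.Theory.
Local Open Scope ring_scope.

(** Induct on a subgroup H of G acting irreducibly on a subspace U.  If H does
not act by scalars, pick y in H acting non-scalarly on U whose commutators with
H are scalars, and x in H whose commutator with y acts as a primitive p-th root
of unity z.  The elements K of H commuting with y on U have index p, x permutes
the p eigenspaces of y on U cyclically, and K acts irreducibly on the
fixed space V of y.  A window xi for V induces the window sum_i c_i xi x^-i for
U.  Writing the elements of H as x^-k y^m h, for a fixed h in K the transform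
becomes a Gabor transform on Z/p with window c of the vector b(h) of the
transforms of the components of f.

For c_i = t^(p^2 - i^2), t a generic large integer, the Gabor transform
determines all products b_i conj(b_j), and the transform of a nonzero vector has
fewer than p zeros.  The zero bound makes the proportion of zeros of the
transform at most d/p, where p^d is at most the dimension.  When 2(d-1) < p,
the transforms of two nonzero components therefore have a common nonzero
value, which synchronizes their phases.  Finally p^(2d) <= |G| <= p^(2+p/2)
gives d <= 1 + p/4. *)

(** * Zeros of Gauss sums with periodic polynomial coefficients *)

Lemma primitive_root_neq0 (F : fieldType) (n : nat) (z : F) :
  n.-primitive_root z -> z != 0.
Proof.
move=> z_prim; apply/eqP=> z0; have /eqP := prim_expr_order z_prim.
by rewrite z0 expr0n eqn0Ngt (prim_order_gt0 z_prim) eq_sym oner_eq0.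
Qed.

Section DominantIndices.
Variables (F : fieldType) (p : nat) (z : F) (B : nat -> {poly F}).
Hypotheses (z_prim : p.-primitive_root z) (B_periodic : forall i, B (i + p) = B i).
Hypothesis B_neq0 : exists i, B i != 0.

Let p_gt0 : (0 < p)%N := prim_order_gt0 z_prim.

(** For [k <= i < k + p] and [B i != 0], this is the size of ['X^(p ^ 2 - (i - k) ^ 2) * B i], which
    is the term of index [i] in [gauss_sum k m] up to a root of unity. *)
Definition shift_size k i := (size (B i) + (p ^ 2 - (i - k) ^ 2))%N.

Definition dominant k i :=
  [&& (k <= i < k + p)%N, B i != 0
    & [forall r : 'I_p, (B (k + r) != 0) ==>
        (shift_size k (k + r) <= shift_size k i)%N]].

Lemma dominantP k i : dominant k i ->
  [/\ (k <= i < k + p)%N, B i != 0 &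
    forall j, (k <= j < k + p)%N -> B j != 0 ->
      (shift_size k j <= shift_size k i)%N].
Proof.
case/and3P=> ki Bi /forallP dom; split=> // j /andP[kj jk] Bj.
have jp : (j - k < p)%N by lia.
by have /implyP := dom (Ordinal jp); rewrite /= subnKC //; apply.
Qed.

Lemma periodic_mod i : B (i %% p) = B i.
Proof.
rewrite {2}(divn_eq i p) addnC; elim: (i %/ p)%N => [|q IHq].
  by rewrite mul0n addn0.
by rewrite mulSn addnCA addnC B_periodic.
Qed.

Lemma dominant_ex k : exists i, dominant k i.
Proof.
have [i Bi] := B_neq0.
have rp : ((i + k * p.-1) %% p < p)%N by rewrite ltn_mod.
have Br : B (k + Ordinal rp) != 0.
  rewrite /= -periodic_mod modnDmr periodic_mod addnCA -mulnS prednK //.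
  by rewrite -periodic_mod addnC modnMDl periodic_mod.
have [r Br' rmax] := @arg_maxnP _ (Ordinal rp) (fun r : 'I_p => B (k + r) != 0)
  (fun r => shift_size k (k + r)) Br.
exists (k + r)%N; apply/and3P; split=> //.
  by rewrite leq_addr ltn_add2l ltn_ord.
by apply/forallP=> s; apply/implyP; apply: rmax.
Qed.

(* Exchange argument: [r |-> p^2 - r^2] is strictly concave. *)
Lemma dominant_mono k i j : dominant k i -> dominant k.+1 j -> (i <= j)%N.
Proof.
move=> /dominantP[ki Bi di] /dominantP[kj Bj dj].
rewrite leqNgt; apply/negP=> ji.
have := di j; have := dj i; rewrite /shift_size Bi Bj.
have -> : (i - k = (i - k.+1).+1)%N by lia.
have -> : (j - k = (j - k.+1).+1)%N by lia.
move: (size (B i)) (size (B j)) => s s'.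
set u := (i - k.+1)%N; set v := (j - k.+1)%N.
have uv : (v < u)%N by rewrite /u /v; lia.
have up : (u.+1 < p)%N by rewrite /u; lia.
have u2 : (u.+1 ^ 2 <= p ^ 2)%N by rewrite leq_sqr ltnW.
have v2 : (v.+1 ^ 2 <= u.+1 ^ 2)%N by rewrite leq_sqr ltnW.
move=> H1 H2.
have {H1} : (s + (p ^ 2 - u ^ 2) <= s' + (p ^ 2 - v ^ 2))%N by apply: H1; lia.
have {H2} : (s' + (p ^ 2 - v.+1 ^ 2) <= s + (p ^ 2 - u.+1 ^ 2))%N by apply: H2; lia.
move: u2 v2; rewrite -!mulnn; nia.
Qed.

Lemma shift_sizeDp k i : shift_size (k + p) (i + p) = shift_size k i.
Proof. by rewrite /shift_size B_periodic subnDr. Qed.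

Lemma dominantDp k i : dominant (k + p) (i + p) = dominant k i.
Proof.
rewrite /dominant !leq_add2r ltn_add2r B_periodic; congr [&& _, _ & _].
by apply: eq_forallb => r; rewrite addnAC B_periodic !shift_sizeDp.
Qed.

Lemma dominant_ub k i : dominant k i -> (i <= k + p)%N.
Proof. by case/dominantP=> /andP[_ /ltnW]. Qed.

Definition dom_lo k := ex_minn (dominant_ex k).
Definition dom_hi k := ex_maxn (dominant_ex k) (@dominant_ub k).

Lemma dom_loP k : dominant k (dom_lo k).
Proof. by rewrite /dom_lo; case: ex_minnP. Qed.

Lemma dom_hiP k : dominant k (dom_hi k).
Proof. by rewrite /dom_hi; case: ex_maxnP. Qed.

Lemma dom_lo_min k i : dominant k i -> (dom_lo k <= i)%N.
Proof. by rewrite /dom_lo; case: ex_minnP => j _; apply. Qed.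

Lemma dom_hi_max k i : dominant k i -> (i <= dom_hi k)%N.
Proof. by rewrite /dom_hi; case: ex_maxnP => j _; apply. Qed.

Lemma dom_loDp k : dom_lo (k + p) = (dom_lo k + p)%N.
Proof.
apply/eqP; rewrite eqn_leq dom_lo_min ?dominantDp ?dom_loP //=.
have /andP[plo _] : (k + p <= dom_lo (k + p) < k + p + p)%N.
  by case/dominantP: (dom_loP (k + p)).
have lep : (p <= dom_lo (k + p))%N by lia.
have dl : dominant k (dom_lo (k + p) - p) by rewrite -dominantDp subnK ?dom_loP.
by rewrite addnC -leq_subRL ?dom_lo_min.
Qed.

Definition dom_size k := shift_size k (dom_lo k).

Lemma dom_sizeE k i : dominant k i -> shift_size k i = dom_size k.
Proof.
move=> di; have dl := dom_loP k; rewrite /dom_size.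
have [ki Bi mi] := dominantP di; have [kl Bl ml] := dominantP dl.
by apply/eqP; rewrite eqn_leq ml ?mi.
Qed.

(* If [dom_hi k] and [dom_lo k.+1] never differed, [dom_size] would increase
   strictly along the period, contradicting its periodicity. *)
Lemma sum_dom_width n :
  (\sum_(k < n) (dom_hi k - dom_lo k) + dom_lo 0 < dom_lo n)%N ||
  (\sum_(k < n) (dom_hi k - dom_lo k) + dom_lo 0 <= dom_lo n)%N &&
  (dom_size 0 + n <= dom_size n)%N.
Proof.
elim: n => [|n IHn]; first by rewrite big_ord0 addn0 !leqnn orbT.
rewrite big_ord_recr /=.
have lohi := dom_lo_min (dom_hiP n); have hilo := dominant_mono (dom_hiP n) (dom_loP n.+1).
move: (\sum_(k < n) _)%N IHn => S /orP[lt|/andP[le sz]].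
  apply/orP; left; lia.
move: hilo; rewrite leq_eqVlt => /predU1P[hilo|hilo]; last first.
  apply/orP; left; lia.
apply/orP; right; apply/andP; split; first lia.
have dl := dom_loP n.+1.
(* One index is dominant for both [n] and [n.+1]; its distance to the start of the window drops, so
   its [shift_size] grows. *)
have dn : dominant n (dom_lo n.+1) by rewrite -hilo dom_hiP.
rewrite -(dom_sizeE dl); move: sz; rewrite -(dom_sizeE dn) addnS.
have [/andP[]] := dominantP dl; have [/andP[]] := dominantP dn.
move: (dom_lo n.+1) => i _ ip _ _ ni _ _ _ sz; apply: (leq_ltn_trans sz).
rewrite /shift_size ltn_add2l ltn_sub2l // ?ltn_sqr; lia.
Qed.

Definition gauss_sum k m : {poly F} :=
  \sum_(r < p) z ^+ ((k + r) * m) *: ('X^(p ^ 2 - r ^ 2) * B (k + r)).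

(* The dominant part of [gauss_sum k m] is a polynomial in [z ^+ m] supported on
   the interval of dominant indices. *)
Lemma card_gauss_zeros k :
  (#|[set m : 'I_p | gauss_sum k m == 0%R]| <= dom_hi k - dom_lo k)%N.
Proof.
(* Up to a root of unity, [a i] is the contribution of index [i] in the top degree
   [(dom_size k).-1]. The guard covers the degrees below the power of ['X], where truncated
   subtraction would pick a wrong coefficient. *)
pose a i := if (dom_size k <= p ^ 2 - (i - k) ^ 2)%N then 0 else
   (B i)`_((dom_size k).-1 - (p ^ 2 - (i - k) ^ 2)).
have a0 i : (k <= i < k + p)%N -> ~~ dominant k i -> a i = 0.
  move=> ki ndi; rewrite /a; case: ifP => // /negbT; rewrite -ltnNge => lts.
  have [->|Bi] := eqVneq (B i) 0; first by rewrite coef0.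
  apply: nth_default; rewrite leqNgt; apply: contra ndi => si.
  have [_ _ ml] := dominantP (dom_loP k).
  apply/and3P; split=> //; apply/forallP=> r; apply/implyP=> Br.
  have kr : (k <= k + r < k + p)%N by rewrite leq_addr ltn_add2l ltn_ord.
  apply: (leq_trans (ml _ kr Br)); rewrite -/(dom_size k) /shift_size.
  by move: lts si; move: (p ^ 2 - _)%N (dom_size k) (size (B i)) => w d s; clear; lia.
have alo : a (dom_lo k) != 0.
  have [ki Bi _] := dominantP (dom_loP k).
  rewrite /a /dom_size /shift_size; move: Bi; rewrite -size_poly_gt0 => sB.
  rewrite ifN; last by rewrite -ltnNge; lia.
  rewrite (_ : _ - _ = (size (B (dom_lo k))).-1)%N; last by lia.
  by rewrite -/(lead_coef _) lead_coef_eq0 -size_poly_gt0.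
pose A := \poly_(r < (dom_hi k - dom_lo k).+1) a (dom_lo k + r)%N.
have A0 : A != 0.
  by apply/eqP=> /(congr1 (fun q : {poly F} => q`_0)); rewrite coef_poly coef0 addn0; apply/eqP.
have rootA m : gauss_sum k m = 0 -> root A (z ^+ m).
  move=> /(congr1 (fun q : {poly F} => q`_(dom_size k).-1)).
  rewrite coef0 /gauss_sum coef_sum => H; apply/eqP.
  (* Factoring out [z ^+ (dom_lo k * m)] turns the top coefficient of the Gauss sum into the value
     of [A] at [z ^+ m]. *)
  have zlo : z ^+ (dom_lo k * m) != 0.
    by rewrite expf_neq0 // (primitive_root_neq0 z_prim).
  apply: (mulfI zlo); rewrite mulr0 -[RHS]H horner_poly mulr_sumr.
  have [/andP[kl _] _ _] := dominantP (dom_loP k).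
  have [/andP[_ hk] _ _] := dominantP (dom_hiP k).
  have lohi := dom_lo_min (dom_hiP k).
  have ds : (0 < dom_size k)%N.
    have [_ Bi _] := dominantP (dom_loP k).
    by rewrite /dom_size /shift_size addn_gt0 size_poly_gt0 Bi.
  pose G i := z ^+ (i * m) * a i.
  transitivity (\sum_(k <= i < k + p) G i).
    rewrite (big_cat_nat (n := dom_lo k)) //=; last by lia.
    rewrite (big_cat_nat (n := (dom_hi k).+1) (m := dom_lo k)) //=; last by lia.
    have -> : \sum_(k <= i < dom_lo k) G i = 0.
      rewrite big_nat_cond big1 // => i /andP[/andP[ki il] _].
      rewrite /G a0 ?mulr0 //; first by lia.
      by apply/negP=> /dom_lo_min; lia.
    have -> : \sum_((dom_hi k).+1 <= i < k + p) G i = 0.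
      rewrite big_nat_cond big1 // => i /andP[/andP[ki il] _].
      rewrite /G a0 ?mulr0 //; first by lia.
      by apply/negP=> /dom_hi_max; lia.
    rewrite add0r addr0 -[in RHS](add0n (dom_lo k)) big_addn subSn // big_mkord.
    apply: eq_bigr => r _; rewrite /G [in RHS]addnC mulnDl exprD -exprM.
    by rewrite (mulnC m) -mulrA; congr (_ * _); rewrite mulrC.
  rewrite -[in LHS](add0n k) big_addn addKn big_mkord; apply: eq_bigr => r _.
  rewrite /G addnC coefZ coefXnM /a addKn; congr (_ * _).
  by move: ds; case: (dom_size k).
have := max_poly_roots A0
  (rs := [seq z ^+ (m : 'I_p) | m <- enum [set m : 'I_p | gauss_sum k m == 0%R]]).
rewrite size_map -cardE => H; rewrite -ltnS; apply: (leq_trans (H _ _)).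
- by apply/allP=> _ /mapP[m + ->]; rewrite mem_enum inE => /eqP/rootA.
- rewrite map_inj_in_uniq ?enum_uniq // => m m' _ _ /eqP.
  by rewrite (eq_prim_root_expr z_prim) !modn_small // => /eqP/val_inj.
- exact: size_poly.
Qed.

(** Over one period [dom_lo] advances by exactly [p] while [dom_size] returns to its value; this
    excludes the second alternative of [sum_dom_width], and the first one is strict. *)
Lemma card_gauss_zeros_lt :
  (\sum_(k < p) #|[set m : 'I_p | gauss_sum k m == 0%R]| < p)%N.
Proof.
have le : (\sum_(k < p) #|[set m : 'I_p | gauss_sum k m == 0%R]| <=
           \sum_(k < p) (dom_hi k - dom_lo k))%N.
  by apply: leq_sum => k _; apply: card_gauss_zeros.
apply: (leq_ltn_trans le).
have := sum_dom_width p; have -> : dom_size p = dom_size 0.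
  by rewrite /dom_size -[p in dom_lo p]add0n dom_loDp -{1}[p]add0n shift_sizeDp.
by have := dom_loDp 0; rewrite add0n => ->; lia.
Qed.

End DominantIndices.

(** * The Gabor transform on a cyclic group with a Gaussian window *)

Lemma poly_nonroot_nat (R : numDomainType) (P : {poly R}) (N : nat) :
  P != 0 -> exists2 n, (N <= n)%N & P.[n%:R] != 0.
Proof.
move=> P0; pose s : seq R := [seq (N + i)%:R | i <- iota 0 (size P)].
have /allPn[_ /mapP[i _ ->] Pi] : ~~ all (root P) s.
  apply/negP=> /(max_poly_roots P0); rewrite size_map size_iota ltnn => H.
  suff /H : uniq s by [].
  rewrite map_inj_in_uniq ?iota_uniq // => i j _ _ /eqP.
  by rewrite eqr_nat eqn_add2l => /eqP.
by exists (N + i)%N; rewrite ?leq_addr.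
Qed.

Lemma val_ord_sub q (i l : 'I_q.+1) :
  val (i - l) = if (l <= i)%N then (i - l)%N else (i + q.+1 - l)%N.
Proof.
rewrite /= modnDmr addnBA; last exact: ltnW.
have := ltn_ord i; have := ltn_ord l; move: (val i) (val l) => {}i {}l lq iq.
case: leqP => li; last by rewrite modn_small; lia.
by rewrite -addnBAC // modnDr modn_small; lia.
Qed.

Section GaborWindow.
Variables (C : numClosedFieldType) (q : nat) (z : C).
Hypothesis z_prim : q.+1.-primitive_root z.

Definition gabor (c b : 'I_q.+1 -> C) (k m : 'I_q.+1) : C :=
  \sum_i c (i - k) * z ^+ (i * m) * b i.

(** A one-sided Gaussian, with [i] taken in [0 .. q]; the shift by [q.+1 ^ 2] keeps the exponent
    natural. *)
Definition gauss_window (t : nat) (i : 'I_q.+1) : C :=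
  (t ^ (q.+1 ^ 2 - i ^ 2))%:R.

(** Column [j] is the window translated and modulated by [g j], with [t] replaced by the
    indeterminate: a row vector times this matrix lists Gabor values at the points [g j]. *)
Definition gauss_minor (g : 'I_q.+1 -> 'I_q.+1 * 'I_q.+1) : 'M[{poly C}]_q.+1 :=
  \matrix_(i, j) ('X^(q.+1 ^ 2 - (i - (g j).1)%R ^ 2) * (z ^+ (i * (g j).2))%:P).

(* A kernel vector over [{poly C}] would have [p] vanishing Gauss sums. *)
Lemma gauss_minor_neq0 g : injective g -> \det (gauss_minor g) != 0.
Proof.
move=> g_inj; apply/det0P=> -[v v0 vA].
(* [v] is unrolled to a periodic sequence; its Gauss sums vanish at the [q.+1] distinct points
   [g j], one more than allowed. *)
pose B (i : nat) : {poly C} := v 0 (inord (i %% q.+1)).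
have B_per i : B (i + q.+1)%N = B i by rewrite /B modnDr.
have B0 : exists i, B i != 0.
  have /rV0Pn[i vi] := v0; exists (i : nat).
  by rewrite /B modn_small ?ltn_ord // inord_val.
have := card_gauss_zeros_lt z_prim B_per B0.
under eq_bigr => k _ do rewrite -sum1dep_card.
rewrite pair_big_dep /= sum1dep_card ltnNge => /negP; apply.
rewrite -{1}[q.+1]card_ord -(card_codom g_inj); apply/subset_leq_card/subsetP.
move=> _ /codomP[j ->]; rewrite inE; apply/eqP.
move/rowP: vA => /(_ j); rewrite !mxE => vA; rewrite -[RHS]vA /gauss_sum.
rewrite [RHS](reindex_inj (addIr (g j).1)); apply: eq_bigr => r _.
rewrite !mxE addrK -mul_polyC mulrA mulrC (mulrC _%:P); congr (_ * (_ * _)).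
  by rewrite /B addnC; congr (v 0 _); apply: val_inj; rewrite /= inordK ?ltn_mod.
by rewrite addnC !exprM (prim_expr_mod z_prim).
Qed.

(** One [t] serves every [b]: it avoids the roots of the product of all minors, which are finite in
    number. A nonzero vector with [q.+1] zeros would lie in the kernel of a minor evaluated at
    [t]. *)
Lemma card_gabor_zeros_lt N : exists2 t, (N <= t)%N &
  forall b : 'I_q.+1 -> C, (exists i, b i != 0) ->
  (#|[set km | gabor (gauss_window t) b km.1 km.2 == 0%R]| < q.+1)%N.
Proof.
pose P := \prod_(g : {ffun 'I_q.+1 -> 'I_q.+1 * 'I_q.+1} | injectiveb g)
  \det (gauss_minor g).
have P0 : P != 0 by apply/prodf_neq0 => g /injectiveP; apply: gauss_minor_neq0.
have [t Nt Pt] := poly_nonroot_nat N P0; exists t => // b [i bi].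
set Z := [set _ | _]; rewrite ltnNge; apply/negP=> leZ.
pose g := [ffun j : 'I_q.+1 => enum_val (widen_ord leZ j)].
have g_inj : injectiveb g.
  apply/injectiveP=> j j'; rewrite !ffunE => /enum_val_inj /(congr1 val) /=.
  exact: val_inj.
have : (\det (gauss_minor g)).[t%:R] != 0.
  by apply: contraNneq Pt => dt; rewrite /P (bigD1 g) //= hornerM dt mul0r.
rewrite -[_.[_]]/(horner_eval t%:R (\det (gauss_minor g))) -det_map_mx.
move=> /det0P[]; exists (\row_i b i).
  by apply/rV0Pn; exists i; rewrite mxE.
apply/rowP=> j; rewrite !mxE.
have : g j \in Z by rewrite ffunE enum_valP.
rewrite inE => /eqP gj; rewrite -[RHS]gj; apply: eq_bigr => s _.
rewrite !mxE /= /horner_eval hornerM hornerXn hornerC /gauss_window natrX.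
exact: mulrC.
Qed.

(** Diagonal dominance of a circulant matrix: bounding the [i0] term of each equation by the others
    and summing over [k] compares two multiples of the l1 norm [S] of [X], which forces [S = 0]. *)
Lemma circulant_dominant_inj (u X : 'I_q.+1 -> C) (i0 : 'I_q.+1) :
  \sum_(i | i != i0) `|u i| < `|u i0| ->
  (forall k, \sum_i u (i - k) * X i = 0) -> forall i, X i = 0.
Proof.
move=> dom uX; pose S := \sum_i `|X i|.
have shiftS (i : 'I_q.+1) : \sum_k `|X (i + k)| = S.
  by rewrite /S [RHS](reindex_inj (addrI i)).
have le : `|u i0| * S <= (\sum_(i | i != i0) `|u i|) * S.
  rewrite -(shiftS i0) mulr_sumr.
  apply: (@le_trans _ _ (\sum_k \sum_(i | i != i0) `|u i| * `|X (i + k)|)).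
    apply: ler_sum => k _; have := uX k.
    rewrite (reindex_inj (addIr k)) (bigD1 i0) //= addrK => /eqP.
    rewrite addr_eq0 => /eqP H; rewrite -normrM H normrN.
    apply: (le_trans (ler_norm_sum _ _ _)); apply: ler_sum => i _.
    by rewrite addrK normrM.
  rewrite exchange_big mulr_suml le_eqVlt; apply/orP; left; apply/eqP.
  by apply: eq_bigr => i _; rewrite -mulr_sumr !shiftS.
have S0 : S = 0.
  have S_ge0 : 0 <= S by apply: sumr_ge0 => i _.
  apply/eqP; rewrite -[_ == _]negbK; apply/negP=> Sn0.
  have Sgt0 : 0 < S by rewrite lt_def Sn0.
  by move: le; rewrite ler_pM2r // => /(lt_le_trans dom); rewrite ltxx.
move=> i; apply/eqP; rewrite -normr_eq0; move: S0 => /eqP.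
by rewrite psumr_eq0 // => /allP/(_ i); rewrite mem_index_enum => /(_ isT).
Qed.

(* The largest exponent is attained only at [l] or only at [0], according to
   which of [l] and [p - l] is smaller; they differ as [p] is odd. *)
Lemma gauss_overlap_max (l : 'I_q.+1) : odd q.+1 -> exists i0 : 'I_q.+1,
  forall i : 'I_q.+1, i != i0 ->
  (q.+1 ^ 2 - i ^ 2 + (q.+1 ^ 2 - (i - l)%R ^ 2) <
   q.+1 ^ 2 - i0 ^ 2 + (q.+1 ^ 2 - (i0 - l)%R ^ 2))%N.
Proof.
move=> q_odd.
(* In use, [a] and [b] are the residues of [i] and [i - l], and [c] is the smaller of [l] and
   [q.+1 - l]. At [i0] one residue is [0] and the other is [c]. *)
have key a b c : (a < q.+1)%N -> (b < q.+1)%N -> (c < a)%N || (c < b)%N ->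
    (q.+1 ^ 2 - a ^ 2 + (q.+1 ^ 2 - b ^ 2) < q.+1 ^ 2 + (q.+1 ^ 2 - c ^ 2))%N.
  move=> aq bq; rewrite -(ltn_sqr c a) -(ltn_sqr c b); move: aq bq.
  rewrite -(ltn_sqr a) -(ltn_sqr b).
  by move: (_ ^ 2)%N (a ^ 2)%N (b ^ 2)%N (c ^ 2)%N; clear; lia.
have [h|h] := ltnP l.*2 q.+1; [exists l | exists 0] => i;
  rewrite -val_eqE !val_ord_sub /=; have := ltn_ord i; have := ltn_ord l;
  move: h; move: (nat_of_ord l) (nat_of_ord i) => {}l {}i h lq iq.
- rewrite leqnn subnn subn0 [X in (_ < X)%N]addnC.
  by case: (leqP l i) => li il; apply: key; lia.
- have l_gt0 : (0 < l)%N by lia.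
  rewrite leqn0 (gtn_eqF l_gt0) ?add0n ?subn0.
  by case: (leqP l i) => li il; apply: key; lia.
Qed.

(** The product of the window with its translate by [l] consists of powers of [t] with a unique
    largest exponent; as [t] is at least [q.+1], that power exceeds the sum of the other [q]. *)
Lemma gauss_overlap_inj t (l : 'I_q.+1) (X : 'I_q.+1 -> C) :
  odd q.+1 -> (q.+1 <= t)%N ->
  (forall k, \sum_i gauss_window t (i - k) * gauss_window t (i - k - l) * X i = 0) ->
  forall i, X i = 0.
Proof.
move=> q_odd qt; have [i0] := gauss_overlap_max l q_odd.
pose e (i : 'I_q.+1) := (q.+1 ^ 2 - i ^ 2 + (q.+1 ^ 2 - (i - l)%R ^ 2))%N.
rewrite -/(e i0) => max0.
apply: (@circulant_dominant_inj
  (fun i => gauss_window t i * gauss_window t (i - l)) X i0).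
have uE i : gauss_window t i * gauss_window t (i - l) = (t ^ e i)%:R.
  by rewrite -natrM -expnD.
under eq_bigr => i _ do rewrite uE normr_nat.
rewrite uE normr_nat -natr_sum ltr_nat.
have {}max0 i : i != i0 -> (e i < e i0)%N by exact: max0.
move: (e i0) max0 => M max0; have t_gt0 : (0 < t)%N by lia.
have [M0|M_gt0] := posnP M.
  by rewrite big1 ?expn_gt0 ?t_gt0 // => i /max0; rewrite M0.
apply: (@leq_ltn_trans (\sum_(i : 'I_q.+1 | i != i0) t ^ M.-1)%N).
  by apply: leq_sum => i /max0 ei; apply: leq_pexp2l => //; lia.
rewrite sum_nat_const -[X in (_ < t ^ X)%N](prednK M_gt0) expnS.
by rewrite ltn_pmul2r ?expn_gt0 ?t_gt0 // (cardC1 i0) card_ord.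
Qed.

(** The [T l] are the coefficients of a polynomial of size at most [q.+1] with the [q.+1] distinct
    roots [z ^+ m]. *)
Lemma fourier_inj (T : 'I_q.+1 -> C) :
  (forall m : 'I_q.+1, \sum_l T l * z ^+ (l * m) = 0) -> forall l, T l = 0.
Proof.
move=> HT; pose P := \poly_(i < q.+1) T (inord i).
suff P0 : P = 0.
  move=> l; have := congr1 (fun P : {poly C} => P`_l) P0.
  by rewrite coef_poly ltn_ord inord_val coef0.
apply/eqP/negPn/negP=> P0; have /negP[] : ~~ (q.+1 < size P)%N.
  by rewrite -leqNgt size_poly.
rewrite -[q.+1]card_ord cardE -(size_map (fun m : 'I_q.+1 => z ^+ m)).
apply: max_poly_roots => //; last first.
  rewrite map_inj_uniq ?enum_uniq // => i j /eqP.
  by rewrite (eq_prim_root_expr z_prim) !modn_small // => /eqP/val_inj.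
apply/allP=> _ /mapP[m _ ->]; rewrite /root horner_poly -[X in _ == X](HT m).
by apply/eqP/eq_bigr => l _; rewrite inord_val -exprM mulnC.
Qed.

Lemma conj_primitive_root : z^* = z^-1.
Proof.
have z0 := primitive_root_neq0 z_prim.
apply: (mulfI z0); rewrite divff // -normCK.
suff -> : `|z| = 1 by rewrite expr1n.
apply/eqP; rewrite -(@pexpr_eq1 _ _ q.+1) ?normr_ge0 // -normrX (prim_expr_order z_prim).
by rewrite normr1.
Qed.

(** Expanding the squared modulus by the lag [l] gives a Fourier sum in [m], so each lag can be
    isolated. For a fixed lag, what remains is a correlation in [k] with the window overlap, which
    is injective. *)
Lemma gabor_phase_retrieval t (b b' : 'I_q.+1 -> C) :
  odd q.+1 -> (q.+1 <= t)%N ->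
  (forall k m, `|gabor (gauss_window t) b k m| = `|gabor (gauss_window t) b' k m|) ->
  forall i j, b i * (b j)^* = b' i * (b' j)^*.
Proof.
move=> q_odd qt eqbb' i j; set c := gauss_window t in eqbb'.
pose Y i j := b i * (b j)^* - b' i * (b' j)^*.
suff Y0 l s : Y s (s - l) = 0.
  by apply/eqP; rewrite -subr_eq0 -/(Y i j) -[j](subKr i) Y0.
move: l s => l0 s0.
have cC k : (c k)^* = c k by rewrite /c /gauss_window rmorph_nat.
have normE (b0 : 'I_q.+1 -> C) k m : `|gabor c b0 k m| ^+ 2 =
    \sum_l (\sum_i c (i - k) * c (i - k - l) * (b0 i * (b0 (i - l))^*)) * z ^+ (l * m).
  rewrite normCK /gabor rmorph_sum /= mulr_suml.
  under [RHS]eq_bigr do rewrite mulr_suml.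
  rewrite exchange_big; apply: eq_bigr => s _ /=.
  rewrite (reindex_inj (subrI s)) /= mulr_sumr; apply: eq_bigr => l _.
  rewrite !rmorphM /= cC addrAC rmorphXn /= conj_primitive_root.
  (* With this splitting, the power at [s - l] cancels against its conjugate and only the lag
     remains. *)
  have -> : z ^+ (s * m) = z ^+ ((s - l)%R * m) * z ^+ (l * m).
    rewrite -exprD -mulnDl !exprM -[X in _ = X ^+ m](prim_expr_mod z_prim).
    by rewrite -[X in _ = z ^+ X ^+ m]/(nat_of_ord (s - l + l)%R) subrK.
  have zn0 : z ^+ ((s - l)%R * m) != 0 by rewrite expf_neq0 // (primitive_root_neq0 z_prim).
  rewrite exprVn; field.
  by rewrite zn0.
apply: (@gauss_overlap_inj t l0 (fun s => Y s (s - l0)) q_odd qt _ s0) => k.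
apply: (@fourier_inj
  (fun l => \sum_s c (s - k) * c (s - k - l) * Y s (s - l)) _ l0) => m.
have /eqP := normE b k m; rewrite eqbb' normE eq_sym -subr_eq0 => /eqP H.
rewrite -[RHS]H -sumrB; apply: eq_bigr => l _; rewrite -mulrBl -sumrB.
by congr (_ * _); apply: eq_bigr => s _; rewrite -mulrBr.
Qed.

End GaborWindow.

(** * Sesquilinearity and unitary invariance of the inner product *)

Lemma dotmxZr (C : numClosedFieldType) n (a : C) (f g : 'rV[C]_n) :
  dotmx f (a *: g) = a^* * dotmx f g.
Proof. by rewrite !dotmxE linearZ /= map_mxZ -scalemxAr mxE. Qed.

Lemma dotmxZl (C : numClosedFieldType) n (a : C) (f g : 'rV[C]_n) :
  dotmx (a *: f) g = a * dotmx f g.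
Proof. by rewrite !dotmxE -scalemxAl mxE. Qed.

Lemma dotmx_suml (C : numClosedFieldType) n (I : finType) (f : I -> 'rV[C]_n) g :
  dotmx (\sum_i f i) g = \sum_i dotmx (f i) g.
Proof. by rewrite dotmxE mulmx_suml summxE; apply: eq_bigr => i _; rewrite dotmxE. Qed.

Lemma dotmx_sumr (C : numClosedFieldType) n (I : finType) f (g : I -> 'rV[C]_n) :
  dotmx f (\sum_i g i) = \sum_i dotmx f (g i).
Proof.
rewrite dotmxE mxE; under eq_bigr do rewrite !mxE summxE rmorph_sum mulr_sumr.
rewrite exchange_big; apply: eq_bigr => i _; rewrite dotmxE mxE.
by apply: eq_bigr => k _; rewrite !mxE.
Qed.

Lemma dotmx_unitary (C : numClosedFieldType) n (M : 'M[C]_n) (f g : 'rV[C]_n) :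
  M \is unitarymx -> dotmx (f *m M) (g *m M) = dotmx f g.
Proof.
move=> /unitarymxP MM; rewrite !dotmxE trmx_mul map_mxM /= mulmxA.
by rewrite -[f *m M *m _]mulmxA MM mulmx1.
Qed.

(** * Irreducible subspaces of subgroups, and good windows *)

Section SubgroupModules.
Variables (C : numClosedFieldType) (gT : finGroupType) (G : {group gT}).
Variables (n : nat) (rG : mx_representation C G n).

(** Subspaces are row spaces in the ambient module, so passing to a subgroup changes neither the
    module nor the representation. *)
Definition stable_on (H : {set gT}) (U : 'M[C]_n) :=
  forall h, h \in H -> (U *m rG h <= U)%MS.

Definition simple_on (H : {set gT}) (U : 'M[C]_n) :=
  [/\ U != 0, stable_on H U &
    forall W : 'M_n, stable_on H W -> (W <= U)%MS -> W != 0 -> (U <= W)%MS].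

Definition zero_set (H : {set gT}) (xi f : 'rV[C]_n) :=
  [set h in H | coef_transform rG xi f h == 0].

Definition retrieves_on (H : {set gT}) (U : 'M[C]_n) (xi : 'rV[C]_n) :=
  forall f g : 'rV[C]_n, (f <= U)%MS -> (g <= U)%MS ->
    (forall h, h \in H ->
       `|coef_transform rG xi f h| = `|coef_transform rG xi g h|) ->
    exists c : C, `|c| = 1 /\ f = c *: g.

(** The zeros have proportion at most [d / p]. For a window induced from level [d] the condition for
    retrieval reads [2 * d < p], which ensures that two zero sets of proportion [d / p] do not cover
    the group. *)
Definition good_window (p : nat) (H : {set gT}) (U : 'M[C]_n) (d : nat)
    (xi : 'rV[C]_n) :=
  [/\ (xi <= U)%MS,
      forall f : 'rV[C]_n, (f <= U)%MS -> f != 0 ->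
        (p * #|zero_set H xi f| <= d * #|H|)%N &
      (2 * d.-1 < p)%N -> retrieves_on H U xi].

End SubgroupModules.

(** * The subgroup commuting with [y], and the eigenspaces of [y] *)

Section InductionStep.
Variables (C : numClosedFieldType) (gT : finGroupType) (G : {group gT}).
Variables (n : nat) (rG : mx_representation C G n).
Hypothesis rG_unitary : unitary_repr rG.
Variables (q : nat) (H : {group gT}) (U : 'M[C]_n) (x y : gT) (z : C).
Local Notation p := q.+1.
Hypotheses (p_prime : prime p) (p_odd : odd p) (sHG : H \subset G).
Hypotheses (U_simple : simple_on rG H U) (xH : x \in H) (yH : y \in H).
Hypotheses (xp : (x ^+ p)%g = 1%g) (yp : (y ^+ p)%g = 1%g).
Hypothesis z_prim : p.-primitive_root z.

Let HG h : h \in H -> h \in G. Proof. exact: (subsetP sHG). Qed.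
Let rM g h : g \in H -> h \in H -> rG (g * h)%g = rG g *m rG h.
Proof. by move=> gH hH; rewrite repr_mxM ?HG. Qed.
Let zn0 : z != 0 := primitive_root_neq0 z_prim.

Lemma sub_stable r (u : 'M[C]_(r, n)) h : h \in H -> (u <= U)%MS -> (u *m rG h <= U)%MS.
Proof.
move=> hH uU; apply: submx_trans (submxMr _ uU) _.
by have [_ U_stable _] := U_simple; apply: U_stable.
Qed.

(** Under [comm_H], the scalar [a] is the value at [h] of a character of [H], whose kernel is
    [commuting_set]. *)
Definition commutes_up_to (h : gT) (a : C) :=
  U *m rG h *m rG y = a *: (U *m rG y *m rG h).

Hypothesis comm_x : commutes_up_to x z.
Hypothesis comm_H : forall h, h \in H -> exists j : 'I_p, commutes_up_to h (z ^+ j).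

Lemma commP r (u : 'M[C]_(r, n)) h a : commutes_up_to h a -> (u <= U)%MS ->
  u *m rG h *m rG y = a *: (u *m rG y *m rG h).
Proof.
move=> cha /submxP[w ->].
by rewrite -!(mulmxA w) cha !scalemxAr !mulmxA.
Qed.

Lemma comm_pow r (u : 'M[C]_(r, n)) h a m : h \in H -> commutes_up_to h a ->
  (u <= U)%MS -> u *m rG h *m rG (y ^+ m)%g = a ^+ m *: (u *m rG (y ^+ m)%g *m rG h).
Proof.
move=> hH cha; elim: m r u => [|m IHm] r u uU.
  by rewrite expg0 repr_mx1 !mulmx1 scale1r.
rewrite expgS rM ?groupX // !mulmxA (commP cha) //.
by rewrite -scalemxAl IHm ?sub_stable // scalerA -exprS.
Qed.

Lemma comm1 : commutes_up_to 1 1.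
Proof. by rewrite /commutes_up_to repr_mx1 !mulmx1 scale1r. Qed.

Lemma commM g h a b : g \in H -> h \in H ->
  commutes_up_to g a -> commutes_up_to h b -> commutes_up_to (g * h) (a * b).
Proof.
move=> gH hH ga hb; rewrite /commutes_up_to rM // !mulmxA (commP hb) ?sub_stable //.
by rewrite ga -scalemxAl scalerA mulrC.
Qed.

Lemma commV h a : h \in H -> a != 0 -> commutes_up_to h a -> commutes_up_to h^-1 a^-1.
Proof.
move=> hH a0 ha; have hVH := groupVr hH.
apply: (canRL (scalerK a0)).
have w_sub : (U *m rG h^-1%g <= U)%MS by apply: sub_stable.
have := commP ha w_sub; rewrite -!mulmxA [X in U *m X = _]mulmxA -rM //.
rewrite mulVg repr_mx1 mul1mx => /(congr1 (mulmx^~ (rG h^-1%g))).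
by rewrite -scalemxAl -!mulmxA -[rG h *m _]rM // mulgV repr_mx1 mulmx1 => ->.
Qed.

Lemma commX i : commutes_up_to (x ^+ i) (z ^+ i).
Proof.
elim: i => [|i IHi]; first by rewrite expg0 expr0; apply: comm1.
by rewrite expgS exprS; apply: commM; rewrite ?groupX.
Qed.

Definition commuting_set := [set h in H | U *m rG h *m rG y == U *m rG y *m rG h].

Lemma commuting_setP h : reflect (h \in H /\ commutes_up_to h 1) (h \in commuting_set).
Proof. by rewrite inE /commutes_up_to scale1r; apply: (iffP andP) => -[-> /eqP]. Qed.

Lemma commuting_group_set : group_set commuting_set.
Proof.
apply/group_setP; split; first by apply/commuting_setP; rewrite group1; split=> //; apply: comm1.
move=> g h /commuting_setP[gH cg] /commuting_setP[hH ch].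
by apply/commuting_setP; rewrite groupM //; split=> //; rewrite -[1]mulr1; apply: commM.
Qed.

Definition commuting_group := Group commuting_group_set.
Local Notation K := commuting_group.

Lemma commuting_sub h : h \in K -> h \in H.
Proof. by case/commuting_setP. Qed.

Lemma commuting_y m : (y ^+ m)%g \in K.
Proof. by apply: groupX; apply/commuting_setP; rewrite /commutes_up_to scale1r. Qed.

Lemma commuting_conj h i : h \in K -> (h ^ (x ^+ i))%g \in K.
Proof.
move=> /commuting_setP[hH ch]; apply/commuting_setP; rewrite groupJ ?groupX //; split=> //.
have zi0 : z ^+ i != 0 by rewrite expf_neq0.
have -> : 1 = (z ^+ i)^-1 * (1 * z ^+ i) by rewrite mul1r mulVf.
have xiH : (x ^+ i)%g \in H by rewrite groupX.
apply: commM; rewrite ?groupV ?groupM //; first by apply: commV => //; apply: commX.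
by apply: commM => //; apply: commX.
Qed.

Lemma commuting_conjV h i : h \in K -> (h ^ (x ^+ i)^-1)%g \in K.
Proof.
have -> : ((x ^+ i)^-1 = x ^+ (i * q))%g; last exact: commuting_conj.
by apply: (mulgI (x ^+ i)%g); rewrite mulgV -expgD -mulnS mulnC expgM xp expg1n.
Qed.

(** The character takes the value [z] at [x], so a power of [x] cancels its value at [g], on
    whichever side it multiplies. *)
Lemma coset_decomp g : g \in H -> exists k : 'I_p,
  (x ^+ k * g)%g \in K /\ (g * x ^+ k)%g \in K.
Proof.
move=> gH; have [j cj] := comm_H gH; exists (- j).
have zE : z ^+ (- j)%R * z ^+ j = 1.
  rewrite -exprD -(prim_expr_mod z_prim).
  by rewrite -[(_ %% _)%N]/(nat_of_ord (- j + j)%R) addNr.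
split; apply/commuting_setP; rewrite groupM ?groupX //; split=> //.
  by rewrite -zE; apply: commM; rewrite ?groupX //; apply: commX.
by rewrite -zE mulrC; apply: commM; rewrite ?groupX //; apply: commX.
Qed.

Lemma x_notin_commuting : x \notin K.
Proof.
apply/negP=> /commuting_setP[_]; rewrite /commutes_up_to comm_x => /eqP.
rewrite -subr_eq0 -scalerBl scalemx_eq0 subr_eq0; case/orP.
  rewrite -[z]expr1 -(prim_order_dvd z_prim) dvdn1 => /eqP p1.
  by move: p_prime; rewrite p1.
have [U0 _ _] := U_simple; apply/negP; apply: contra U0 => /eqP U0.
apply/eqP; rewrite -[U]mulmx1 -(repr_mx1 rG) -(mulgV (y * x)%g).
by rewrite rM ?groupV ?groupM // rM // !mulmxA U0 mul0mx.
Qed.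

(** The translates of [K] by the inverses of the [x ^+ k] are disjoint, since the character takes
    distinct values on them. *)
Lemma card_commuting : (p * #|K| <= #|H|)%N.
Proof.
have KH : K \subset H by apply/subsetP; apply: commuting_sub.
pose f (kh : 'I_p * gT) := ((x ^+ kh.1)^-1 * kh.2)%g.
have f_inj : {in setX [set: 'I_p] K &, injective f}.
  move=> [k h] [k' h']; rewrite !in_setX !in_setT /f /= => /commuting_setP[hH ch].
  move=> /commuting_setP[h'H ch'] E.
  suff kk : k = k' by move: E; rewrite kk => /mulgI ->.
  have hE : (h = x ^+ k * ((x ^+ k')^-1 * h'))%g by rewrite -E mulKVg.
  have xH' i : (x ^+ i)%g \in H by rewrite groupX.
  have z0' i : z ^+ i != 0 by rewrite expf_neq0.
  have := commM (xH' k) (groupM (groupVr (xH' k')) h'H) (commX k)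
    (commM (groupVr (xH' k')) h'H (commV (xH' k') (z0' k') (commX k')) ch').
  rewrite -hE /commutes_up_to ch mulr1 => /eqP.
  rewrite -subr_eq0 -scalerBl scalemx_eq0 subr_eq0; case/orP.
    rewrite eq_sym => /eqP zz; have : z ^+ k = z ^+ k'.
      by rewrite -[RHS]mul1r -zz mulfVK.
    by move/eqP; rewrite (eq_prim_root_expr z_prim) !modn_small // => /eqP/val_inj.
  have [U0 _ _] := U_simple; move/eqP=> U1; case/eqP: U0.
  rewrite -[U]mulmx1 -(repr_mx1 rG) -(mulgV (y * h)%g).
  by rewrite rM ?groupV ?groupM // rM // !mulmxA U1 mul0mx.
rewrite -[X in (X * _ <= _)%N]card_ord -cardsT -cardsX -(card_in_imset f_inj).
apply/subset_leq_card/subsetP=> g /imsetP[[k h]].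
by rewrite in_setX => /andP[_ /commuting_sub khH] ->; rewrite groupM ?groupV ?groupX.
Qed.

(** As [y ^+ p = 1], this average is the projection onto the fixed space of [y]. *)
Definition fixed_proj : 'M[C]_n := p%:R^-1 *: \sum_(m < p) rG (y ^+ m)%g.
Local Notation E := fixed_proj.

Let p0 : p%:R != 0 :> C. Proof. by rewrite pnatr_eq0. Qed.

Lemma mul_y_proj : rG y *m E = E.
Proof.
rewrite /E -scalemxAr mulmx_sumr; congr (_ *: _).
rewrite big_ord_recr big_ord_recl /= addrC; congr (_ + _).
  by rewrite -rM ?groupX // -expgS yp expg0.
by apply: eq_bigr => i _; rewrite -rM ?groupX // -expgS.
Qed.

Lemma proj_mul_y : E *m rG y = E.
Proof.
rewrite -[RHS]mul_y_proj /E -scalemxAr -scalemxAl; congr (_ *: _).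
rewrite mulmx_suml mulmx_sumr; apply: eq_bigr => i _.
by rewrite -!rM ?groupX // -expgS expgSr.
Qed.

Lemma fixed_pow r (v : 'M[C]_(r, n)) m : v *m rG y = v -> v *m rG (y ^+ m)%g = v.
Proof.
move=> vy; elim: m => [|m IHm]; first by rewrite repr_mx1 mulmx1.
by rewrite expgS rM ?groupX // mulmxA vy.
Qed.

Lemma fixed_projE r (v : 'M[C]_(r, n)) : v *m rG y = v -> v *m E = v.
Proof.
move=> vy; have vym m := fixed_pow m vy.
rewrite /E -scalemxAr mulmx_sumr; under eq_bigr => m _ do rewrite vym.
by rewrite sumr_const card_ord -scaler_nat scalerA mulVf // scale1r.
Qed.

Lemma eigen_proj0 r (v : 'M[C]_(r, n)) a : a != 1 -> v *m rG y = a *: v -> v *m E = 0.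
Proof.
move=> a1 vy; have /eqP : v *m E = a *: (v *m E).
  by rewrite scalemxAl -vy -mulmxA mul_y_proj.
rewrite eq_sym -subr_eq0 -{2}[v *m E]scale1r -scalerBl scalemx_eq0 subr_eq0.
by rewrite (negPf a1) => /eqP.
Qed.

Lemma sub_proj r (u : 'M[C]_(r, n)) : (u <= U)%MS -> (u *m E <= U)%MS.
Proof.
move=> uU; rewrite /E -scalemxAr scalemx_sub // mulmx_sumr summx_sub // => m _.
by rewrite sub_stable ?groupX.
Qed.

Lemma comm_proj r (u : 'M[C]_(r, n)) h : h \in K -> (u <= U)%MS ->
  u *m rG h *m E = u *m E *m rG h.
Proof.
move=> /commuting_setP[hH ch] uU; rewrite /E -!scalemxAr -scalemxAl; congr (_ *: _).
rewrite !mulmx_sumr mulmx_suml; apply: eq_bigr => m _.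
by rewrite (comm_pow _ hH ch) // expr1n scale1r.
Qed.

(** The conjugates of [E] by the powers of [x] are, on [U], the projections onto the [p] eigenspaces
    of [y]. In their sum, orthogonality of roots of unity kills every power of [y] except
    [m = 0]. *)
Lemma sum_shifted_proj r (u : 'M[C]_(r, n)) : (u <= U)%MS ->
  \sum_(i < p) u *m rG (x ^+ i)%g *m E *m rG (x ^+ i)^-1%g = u.
Proof.
move=> uU; have -> : \sum_(i < p) u *m rG (x ^+ i)%g *m E *m rG (x ^+ i)^-1%g =
    \sum_(m < p) (p%:R^-1 * \sum_(i < p) z ^+ (i * m)) *: (u *m rG (y ^+ m)%g).
  under [RHS]eq_bigr do rewrite mulr_sumr scaler_suml.
  rewrite exchange_big; apply: eq_bigr => i _ /=.
  rewrite /E -scalemxAr -scalemxAl mulmx_sumr mulmx_suml scaler_sumr.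
  apply: eq_bigr => m _.
  rewrite (comm_pow _ _ (commX i)) ?groupX // -scalemxAl -mulmxA -rM ?groupV ?groupX //.
  by rewrite mulgV repr_mx1 mulmx1 scalerA exprM.
rewrite (bigD1 ord0) //= [X in _ + X]big1 => [|m m0].
  under eq_bigr do rewrite muln0 expr0.
  by rewrite sumr_const card_ord mulVf // scale1r expg0 repr_mx1 mulmx1 addr0.
suff -> : \sum_(i < p) z ^+ (i * m) = 0 by rewrite mulr0 scale0r.
have zm1 : z ^+ m != 1.
  by rewrite -(prim_order_dvd z_prim) gtnNdvd // lt0n.
under eq_bigr do rewrite mulnC exprM.
apply: (mulfI (_ : z ^+ m - 1 != 0)); first by rewrite subr_eq0.
by rewrite mulr0 -subrX1 -exprM mulnC exprM (prim_expr_order z_prim) expr1n subrr.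
Qed.

Local Notation V0 := (U *m E).

Lemma V0_sub : (V0 <= U)%MS. Proof. exact: sub_proj. Qed.

Lemma V0_fixed r (v : 'M[C]_(r, n)) : (v <= V0)%MS -> v *m rG y = v.
Proof. by case/submxP=> w ->; rewrite -!mulmxA proj_mul_y. Qed.

Lemma eigen_shift r (v : 'M[C]_(r, n)) i m : (v <= V0)%MS ->
  v *m rG (x ^+ i)^-1%g *m rG (y ^+ m)%g = (z ^+ i)^-1 ^+ m *: (v *m rG (x ^+ i)^-1%g).
Proof.
move=> vV; have vU := submx_trans vV V0_sub.
have xiH : (x ^+ i)%g \in H by rewrite groupX.
have zi0 : z ^+ i != 0 by rewrite expf_neq0.
rewrite (comm_pow _ _ (commV xiH zi0 (commX i))) ?groupV //.
by rewrite fixed_pow // V0_fixed.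
Qed.

(** The translates of a [K]-stable [W] by powers of [x] span an [H]-stable space, which contains
    [U]. Applying [E] kills every translate but [W] itself, so [V0] lies in [W]. *)
Lemma V0_simple : simple_on rG K V0.
Proof.
have [U0 U_stable U_min] := U_simple; split.
- apply: contra U0 => /eqP V00; rewrite -(sum_shifted_proj (submx_refl U)).
  rewrite big1 // => i _; have /submxP[w ->] : (U *m rG (x ^+ i)%g <= U)%MS.
    by rewrite sub_stable ?groupX.
  by rewrite -(mulmxA w) V00 mulmx0 mul0mx.
- move=> h hK; have hH := commuting_sub hK; rewrite -comm_proj //.
  by rewrite submxMr // sub_stable.
move=> W W_stable WV W0.
pose T : 'M_n := (\sum_(i < p) W *m rG (x ^+ i)^-1%g)%MS.
have T_stable : stable_on rG H T.
  move=> g gH; rewrite sumsmxMr; apply/sumsmx_subP=> i _.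
  have gH' : ((x ^+ i)^-1 * g)%g \in H by rewrite groupM ?groupV ?groupX.
  have [k [_ hK]] := coset_decomp gH'.
  rewrite -mulmxA -rM ?groupV ?groupX // -[((x ^+ i)^-1 * g)%g](mulgK (x ^+ k)%g).
  rewrite rM ?groupV ?groupX ?(commuting_sub hK) // mulmxA.
  by apply: (sumsmx_sup k) => //; rewrite submxMr ?W_stable.
have UT : (U <= T)%MS.
  apply: U_min => //.
    apply/sumsmx_subP=> i _; rewrite sub_stable ?groupV ?groupX //.
    exact: submx_trans WV V0_sub.
  apply: contra W0 => /eqP T0; rewrite -submx0 -T0.
  by apply: (sumsmx_sup ord0) => //; rewrite expg0 invg1 repr_mx1 mulmx1.
apply: submx_trans (submxMr E UT) _; rewrite sumsmxMr; apply/sumsmx_subP=> i _.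
have [->|i0] := eqVneq i ord0.
  by rewrite expg0 invg1 repr_mx1 mulmx1 fixed_projE // V0_fixed.
rewrite (@eigen_proj0 _ _ (z ^+ i)^-1) ?sub0mx //; last first.
  by have := eigen_shift i 1 WV; rewrite expg1 expr1.
by rewrite invr_eq1 -(prim_order_dvd z_prim) gtnNdvd // lt0n.
Qed.

(** The [p] translates of [V0] lie in distinct eigenspaces of [y], so their sum inside [U] is
    direct. *)
Lemma rank_V0 : (p * \rank V0 <= \rank U)%N.
Proof.
pose e (i : 'I_p) := (z ^+ i)^-1.
have e_inj : {in predT &, injective e}.
  move=> i j _ _ /invr_inj /eqP; rewrite (eq_prim_root_expr z_prim) !modn_small //.
  by move/eqP/val_inj.
have dxe := mxdirect_sum_eigenspace (rG y) e_inj.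
pose T i := V0 *m rG (x ^+ (i : 'I_p))^-1%g.
have Te i : (T i <= eigenspace (rG y) (e i))%MS.
  by apply/eigenspaceP; have := eigen_shift i 1 (submx_refl V0); rewrite expg1 expr1.
have dxT : mxdirect (\sum_i T i).
  apply/mxdirect_sumsP=> i _; apply/eqP; rewrite -submx0.
  rewrite -[X in (_ <= X)%MS](mxdirect_sumsP dxe i isT) capmxS ?Te //.
  by apply/sumsmx_subP=> j ji; apply: (sumsmx_sup j) => //; apply: Te.
have /mxrankS : (\sum_i T i <= U)%MS.
  by apply/sumsmx_subP=> i _; rewrite sub_stable ?groupV ?groupX // V0_sub.
rewrite (mxdirectP dxT) /= => /(leq_trans _); apply.
rewrite (eq_bigr (fun=> \rank V0)) => [|i _]; first by rewrite sum_nat_const card_ord.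
by rewrite /T mxrankMfree // row_free_unit repr_mx_unit // HG ?groupV ?groupX.
Qed.

(** By unitarity, every term of the average has the same inner product with a vector fixed by
    [y]. *)
Lemma dotmx_proj (u v : 'rV[C]_n) : v *m rG y = v -> dotmx (u *m E) v = dotmx u v.
Proof.
move=> vy; have vym m := fixed_pow m vy.
rewrite /E -scalemxAr dotmxZl mulmx_sumr dotmx_suml.
rewrite (eq_bigr (fun=> dotmx u v)) => [|m _].
  by rewrite sumr_const card_ord -[dotmx u v *+ _]mulr_natl mulrA mulVf ?mul1r.
by rewrite -{1}(vym m) dotmx_unitary // rG_unitary // HG ?groupX.
Qed.

(** * The induced window: transform, zeros and phase retrieval *)

Variables (xi : 'rV[C]_n) (d t : nat).
Hypotheses (xi_good : good_window rG p K V0 d xi) (pt : (p <= t)%N).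
Hypothesis t_generic : forall b : 'I_p -> C, (exists i, b i != 0) ->
  (#|[set km | gabor z (gauss_window C t) b km.1 km.2 == 0%R]| < p)%N.

Let xiV : (xi <= V0)%MS. Proof. by case: xi_good. Qed.

(** The part of [f] in the eigenspace of [y] for [z ^- i], carried back into [V0] by [x ^+ i]. *)
Definition component (i : nat) (f : 'rV[C]_n) := f *m rG (x ^+ i)%g *m E.

Definition induced_window : 'rV[C]_n :=
  \sum_i gauss_window C t i *: (xi *m rG (x ^+ (i : 'I_p))^-1%g).

Definition comp_coef (f : 'rV[C]_n) (h : gT) (i : 'I_p) :=
  coef_transform rG xi f ((x ^+ i)^-1 * h)%g.

Lemma component_sub i f : (f <= U)%MS -> (component i f <= V0)%MS.
Proof. by move=> fU; rewrite submxMr // sub_stable ?groupX. Qed.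

Lemma sum_components f : (f <= U)%MS ->
  f = \sum_(i < p) component i f *m rG (x ^+ i)^-1%g.
Proof. by move=> fU; rewrite sum_shifted_proj. Qed.

Lemma comp_coefE f h i : h \in K ->
  comp_coef f h i = coef_transform rG xi (component i f) (h ^ (x ^+ i))%g.
Proof.
move=> hK; have hH := commuting_sub hK; have xiH : (x ^+ i)%g \in H by rewrite groupX.
have hxK := commuting_conj i hK; have hxH := commuting_sub hxK.
rewrite /coef_transform /component dotmx_proj; last first.
  have /commuting_setP[_ ch] := hxK.
  by rewrite (commP ch) ?scale1r ?V0_fixed // (submx_trans xiV V0_sub).
rewrite conjgE mulgA rM ?groupM ?groupV // mulmxA dotmx_unitary //.
exact/rG_unitary/HG.
Qed.

(** The factor in [x] translates the index by [k]; [y ^+ m] acts on each shifted window by a root of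
    unity, whose conjugate supplies the modulation. *)
Lemma induced_window_coef f h k m : h \in K ->
  coef_transform rG induced_window f ((x ^+ (k : 'I_p))^-1 * (y ^+ (m : 'I_p) * h))%g =
  gabor z (gauss_window C t) (comp_coef f h) k m.
Proof.
move=> hK; have hH := commuting_sub hK.
have xH' i : (x ^+ i)^-1%g \in H by rewrite groupV groupX.
have yH' i : (y ^+ i)%g \in H by rewrite groupX.
rewrite /coef_transform /induced_window mulmx_suml dotmx_sumr /gabor.
rewrite [RHS](reindex_inj (addIr k)); apply: eq_bigr => i _.
rewrite addrK -scalemxAl dotmxZr -mulrA.
congr (_ * _); first by rewrite /gauss_window rmorph_nat.
rewrite -mulmxA -rM ?groupM // !mulgA -invMg -expgD.
have -> : (x ^+ (k + i) = x ^+ (i + k)%R)%g.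
  by rewrite /= expg_mod // addnC.
rewrite !rM ?groupM // !mulmxA (eigen_shift _ _ xiV) -scalemxAl dotmxZr.
rewrite /comp_coef /coef_transform rM // mulmxA; congr (_ * _).
by rewrite rmorphXn fmorphV rmorphXn /= (conj_primitive_root z_prim) exprVn invrK exprM.
Qed.

Lemma induced_window_sub : (induced_window <= U)%MS.
Proof.
apply: summx_sub => i _; rewrite scalemx_sub // sub_stable ?groupV ?groupX //.
exact: submx_trans xiV V0_sub.
Qed.

Lemma card_comp_zeros f (i : 'I_p) : (f <= U)%MS -> component i f != 0 ->
  (p * #|[set h in K | comp_coef f h i == 0%R]| <= d * #|K|)%N.
Proof.
move=> fU fi0; have [_ zeros _] := xi_good.
apply: leq_trans (zeros _ (component_sub i fU) fi0); rewrite leq_mul2l /=.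
rewrite -(card_imset _ (conjg_inj (x ^+ i)%g)); apply/subset_leq_card/subsetP=> g.
case/imsetP=> h; rewrite inE => /andP[hK /eqP h0] ->.
by rewrite inE commuting_conj //= -comp_coefE // h0.
Qed.

Lemma exists_component_neq0 f : (f <= U)%MS -> f != 0 ->
  exists i : 'I_p, component i f != 0.
Proof.
move=> fU f0; apply/existsP; apply: contraR f0; rewrite negb_exists => /forallP c0.
rewrite (sum_components fU) big1 // => i _.
by have := c0 i; rewrite negbK => /eqP ->; rewrite mul0mx.
Qed.

(** For each [h] in [K], the [p ^ 2] points [(k, m)] carry fewer than [p] zeros unless the vector
    [comp_coef f h] vanishes. This requires in particular a zero at [i0], which has proportion at
    most [d / p]; hence the total [d.+1]. *)
Lemma induced_window_zeros f : (f <= U)%MS -> f != 0 ->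
  (p * #|zero_set rG H induced_window f| <= d.+1 * #|H|)%N.
Proof.
move=> fU f0; have [i0 fi0] := exists_component_neq0 fU f0.
pose D (k : 'I_p) (h : gT) :=
  coef_transform rG induced_window f ((x ^+ k)^-1 * h)%g == 0.
pose N := (\sum_(k < p) \sum_(h in K) D k h)%N.
have leN : (#|zero_set rG H induced_window f| <= N)%N.
  pose S := [set kh : 'I_p * gT | (kh.2 \in K) && D kh.1 kh.2].
  have -> : N = #|S|.
    rewrite -sum1dep_card -(pair_big_dep xpredT
      (fun k h => (h \in K) && D k h) (fun _ _ => 1%N)) /=.
    apply: eq_bigr => k _; rewrite big_mkcondr /=.
    by apply: eq_bigr => h _; case: (D k h).
  apply: leq_trans (leq_imset_card (fun kh : 'I_p * gT => (x ^+ kh.1)^-1 * kh.2)%g S).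
  apply/subset_leq_card/subsetP=> g; rewrite inE => /andP[gH g0].
  have [k [hK _]] := coset_decomp gH.
  by apply/imsetP; exists (k, (x ^+ k * g)%g); rewrite /= ?mulKg // inE hK /D mulKg.
pose A := [set h in K | comp_coef f h i0 == 0].
have le_pN : (p * N <= p * (p * #|A|) + p * #|K|)%N.
  (* Left multiplication by [y ^+ m] permutes [K], so averaging over [m] brings in whole Gabor
     transforms. *)
  have -> : (p * N = \sum_(h in K) \sum_(m < p) \sum_(k < p) D k (y ^+ m * h)%g)%N.
    rewrite exchange_big (eq_bigr (fun=> N)) /= => [|m _].
      by rewrite sum_nat_const card_ord.
    rewrite exchange_big; apply: eq_bigr => k _.
    rewrite [RHS](reindex_inj (mulgI (y ^+ m)%g)); apply: eq_bigl => h.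
    by symmetry; apply: groupMl; apply: commuting_y.
  apply: (@leq_trans (\sum_(h in K) (p * (p * (h \in A)) + p))%N); last first.
    rewrite big_split /= sum_nat_const mulnC leq_add2r -!big_distrr /= !leq_mul2l /=.
    rewrite -sum1_card big_mkcond [X in (_ <= X)%N]big_mkcond leq_sum // => h _.
    by case: (h \in K); case: (h \in A).
  apply: leq_sum => h hK; rewrite exchange_big /=.
  have -> : (\sum_(k < p) \sum_(m < p) D k (y ^+ m * h)%g =
    #|[set km | gabor z (gauss_window C t) (comp_coef f h) km.1 km.2 == 0%R]|)%N.
    rewrite -sum1dep_card pair_big [RHS]big_mkcond /=; apply: eq_bigr => -[k m] _ /=.
    by rewrite /D induced_window_coef //; case: (_ == 0).
  case hA: (h \in A).
    by apply: (leq_trans (max_card _)); rewrite card_prod card_ord muln1 leq_addr.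
  rewrite muln0 muln0 add0n; apply/ltnW/t_generic; exists i0.
  by move: hA; rewrite inE hK => /negbT.
have leA := card_comp_zeros fU fi0.
have leH := card_commuting.
apply: leq_trans (leq_mul (leqnn d.+1) leH).
apply: leq_trans (leq_mul (leqnn p) leN) _; apply: (leq_trans le_pN).
rewrite [(d.+1 * _)%N]mulSn [X in (_ <= X)%N]addnC leq_add2r [X in (_ <= X)%N]mulnCA leq_mul2l /=.
exact: leA.
Qed.

(** The diagonal products [i = j] give the moduli of the component transforms, so each component is
    known up to its own phase; the products with [i0] then make the phases agree. *)
Lemma induced_window_retrieves : (2 * d < p)%N -> retrieves_on rG H U induced_window.
Proof.
move=> d_small f g fU gU eq_fg; have [_ _ retr] := xi_good.
have cross h i j : h \in K ->
    comp_coef f h i * (comp_coef f h j)^* = comp_coef g h i * (comp_coef g h j)^*.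
  move=> hK; apply: (gabor_phase_retrieval z_prim p_odd pt) => k m.
  rewrite -!induced_window_coef // eq_fg //.
  by rewrite groupM ?groupV ?groupX // groupM ?groupX ?(commuting_sub hK).
have phase i : exists c : C, `|c| = 1 /\ component (i : 'I_p) f = c *: component i g.
  apply: retr; rewrite ?component_sub //.
    by apply: leq_ltn_trans d_small; rewrite leq_mul2l leq_pred orbT.
  move=> h hK; have hxK := commuting_conjV i hK.
  rewrite -[h](conjgKV (x ^+ i)%g) -!comp_coefE //.
  have := cross _ i i hxK; rewrite -!normCK => /eqP.
  by rewrite eqrXn2 // => /eqP.
have coef_phase i c h : h \in K -> component (i : 'I_p) f = c *: component i g ->
    comp_coef f h i = c * comp_coef g h i.
  by move=> hK E; rewrite !comp_coefE // E /coef_transform dotmxZl.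
have [/existsP[i0 gi0]|] := boolP [exists i : 'I_p, component i g != 0]; last first.
  rewrite negb_exists => /forallP g0; exists 1; rewrite normr1; split=> //.
  rewrite scale1r (sum_components fU) (sum_components gU); apply: eq_bigr => i _.
  have [c [_ ->]] := phase i; have := g0 i; rewrite negbK => /eqP ->.
  by rewrite scaler0.
have [c [c1 fc]] := phase i0; exists c; split=> //.
rewrite (sum_components fU) (sum_components gU) scaler_sumr.
apply: eq_bigr => i _; rewrite scalemxAl; congr (_ *m _).
have [c' [c'1 fc']] := phase i; rewrite fc'.
have [->|gi] := eqVneq (component i g) 0; first by rewrite !scaler0.
pose A j := [set h in K | comp_coef g h j == 0].
(* Since [2 * d < p], the two zero sets are too small to cover [K]. *)
have [h hK hA] : exists2 h, h \in K & h \notin A i :|: A i0.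
  apply/subsetPn/negP=> /subset_leq_card leK.
  have := leq_trans leK (leq_card_setU _ _).
  have := card_comp_zeros gU gi; have := card_comp_zeros gU gi0.
  rewrite -/(A i) -/(A i0); have := cardG_gt0 K; move: #|A i| #|A i0| #|K| => a b k k_gt0 Hb Ha Hk.
  have := leq_mul (leqnn p) Hk; rewrite mulnDr => {}Hk.
  have : (p * k <= d * k + d * k)%N by apply: leq_trans Hk (leq_add Ha Hb).
  by rewrite addnn -mul2n mulnA leq_pmul2r // leqNgt d_small.
move: hA; rewrite in_setU negb_or => /andP[].
rewrite inE hK /= => hi; rewrite inE hK /= => hi0.
have := cross h i i0 hK; rewrite (coef_phase _ _ _ hK fc') (coef_phase _ _ _ hK fc).
rewrite rmorphM /= mulrACA -[RHS]mul1r => /mulIf cc.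
have {}cc : c' * c^* = 1 by apply: cc; rewrite mulf_neq0 // conjC_eq0.
congr (_ *: _); rewrite -[RHS]mul1r -cc -mulrA [c^* * _]mulrC -normCK c1 expr1n.
by rewrite mulr1.
Qed.

End InductionStep.

(** * Existence of good windows by induction on the subgroup *)

Lemma prime_primitive_root_exists (C : numClosedFieldType) (p : nat) :
  prime p -> exists z : C, p.-primitive_root z.
Proof.
move=> p_prime; have p_gt1 := prime_gt1 p_prime.
(* A root of the sum of the ['X^i] for [i < p] is a [p]-th root of unity, and differs from [1],
   where the sum is [p]. *)
have sz : size (\poly_(i < p) (1 : C)) = p by apply: size_poly_eq; rewrite oner_eq0.
have [z /eqP] : exists z : C, root (\poly_(i < p) 1) z.
  by apply/closed_rootP; rewrite sz neq_ltn p_gt1 orbT.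
rewrite horner_poly => z0; have zp : z ^+ p = 1.
  apply/eqP; rewrite -subr_eq0 subrX1.
  by under eq_bigr do rewrite -[_ ^+ _]mul1r; rewrite z0 mulr0.
exists z; have [m z_prim /(prime_nt_dvdP p_prime) dvd] := prim_order_exists (prime_gt0 p_prime) zp.
have [m1|m1] := eqVneq m 1%N; last by rewrite -(dvd m1).
move: z_prim z0; rewrite m1 => /prim_expr_order; rewrite expr1 => ->.
under eq_bigr do rewrite expr1n mulr1.
by rewrite sumr_const card_ord => /eqP; rewrite pnatr_eq0 -leqn0 leqNgt prime_gt0.
Qed.

(** [y] is taken in the last lower central term not inside [S]; its commutators fall into the next
    term. *)
Lemma lower_central_escape (gT : finGroupType) (H : {group gT}) (S : {set gT}) :
  nilpotent H -> 1%g \in S -> ~~ (H \subset S) ->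
  exists2 y, y \in H :\: S & forall h, h \in H -> [~ h, y]%g \in S.
Proof.
move=> /lcnP[c Lc] S1 HS; have ex : exists i, 'L_i.+1(H)%g \subset S.
  by exists c; rewrite Lc sub1set.
case: (ex_minnP ex) => [[|i] LS Lmin]; first by rewrite lcn1 (negPf HS) in LS.
have /subsetPn[y yL yS] : ~~ ('L_i.+1(H)%g \subset S).
  by apply/negP=> /Lmin; rewrite ltnn.
exists y; first by rewrite inE yS (subsetP (lcn_sub _ _) _ yL).
by move=> h hH; apply: (subsetP LS); rewrite lcnSn commGC mem_commg.
Qed.

Section WindowExists.
Variables (C : numClosedFieldType) (gT : finGroupType) (G : {group gT}).
Variables (n : nat) (rG : mx_representation C G n) (q : nat).
Local Notation p := q.+1.
Hypotheses (rG_unitary : unitary_repr rG) (p_prime : prime p) (pG : (p.-group G)%g).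
Hypothesis Gp : forall x, x \in G -> (x ^+ p)%g = 1%g.

(** Schur's lemma through the spectral projections of [y]: some eigenspace meets [U] nontrivially
    and is stable under [H], hence is all of [U]. This also shows that the eigenvalue is a power of
    [z]. *)
Lemma schur_scalar (H : {group gT}) (U : 'M[C]_n) (y : gT) (z : C) :
  H \subset G -> simple_on rG H U -> y \in H -> p.-primitive_root z ->
  (forall h, h \in H -> U *m rG h *m rG y = U *m rG y *m rG h) ->
  exists j : 'I_p, U *m rG y = z ^+ j *: U.
Proof.
move=> sHG [U0 U_stable U_min] yH z_prim cH.
have yG : y \in G by rewrite (subsetP sHG).
have zn0 := primitive_root_neq0 z_prim.
(* [P j] is [p] times the projection onto the [z ^+ j] eigenspace of [y]. *)
pose P (j : 'I_p) : 'M[C]_n := \sum_(m < p) z ^- (j * m) *: rG (y ^+ m)%g.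
have Py j : P j *m rG y = z ^+ j *: P j.
  pose Q m := z ^+ j * z ^- (j * m) *: rG (y ^+ m)%g.
  have -> : P j *m rG y = \sum_(m < p) Q m.+1.
    rewrite mulmx_suml; apply: eq_bigr => m _; rewrite -scalemxAl -repr_mxM ?groupX //.
    rewrite -expgSr /Q mulnS exprD invfM mulrA divff ?mul1r //.
    by rewrite expf_neq0.
  have -> : z ^+ j *: P j = \sum_(m < p) Q m.
    by rewrite scaler_sumr; apply: eq_bigr => m _; rewrite scalerA.
  rewrite big_ord_recr big_ord_recl /= addrC; congr (_ + _).
  rewrite /Q Gp // mulnC exprM (prim_expr_order z_prim) expr1n.
  by rewrite muln0 expg0.
have sumP : \sum_j P j = p%:R *: 1%:M.
  rewrite exchange_big (bigD1 ord0) //= [X in _ + X]big1 => [|m m0].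
    under eq_bigr do rewrite muln0 expr0 invr1 scale1r expg0 repr_mx1.
    by rewrite sumr_const card_ord addr0 scaler_nat.
  rewrite -scaler_suml; suff -> : \sum_(j < p) z ^- (j * m) = 0 by rewrite scale0r.
  have zm1 : z ^- m != 1.
    by rewrite invr_eq1 -(prim_order_dvd z_prim) gtnNdvd // lt0n.
  under eq_bigr do rewrite mulnC exprM -exprVn.
  apply: (mulfI (_ : z ^- m - 1 != 0)); first by rewrite subr_eq0.
  rewrite mulr0 -subrX1 exprVn -exprM mulnC exprM (prim_expr_order z_prim) expr1n.
  by rewrite invr1 subrr.
have stab r (u : 'M[C]_(r, n)) h : h \in H -> (u <= U)%MS -> (u *m rG h <= U)%MS.
  by move=> hH uU; apply: submx_trans (submxMr _ uU) (U_stable _ hH).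
have cHm h m r (u : 'M[C]_(r, n)) : h \in H -> (u <= U)%MS ->
    u *m rG h *m rG (y ^+ m)%g = u *m rG (y ^+ m)%g *m rG h.
  move=> hH; have hG : h \in G by rewrite (subsetP sHG).
  elim: m r u => [|m IHm] r u uU; first by rewrite expg0 repr_mx1 !mulmx1.
  rewrite expgS repr_mxM ?groupX // !mulmxA -IHm ?stab //.
  by case/submxP: uU => w ->; rewrite -!(mulmxA w) cH.
have [j UPj] : exists j, U *m P j != 0.
  apply/existsP; apply: contraR U0; rewrite negb_exists => /forallP P0.
  have /eqP : U *m (\sum_j P j) = 0.
    by rewrite mulmx_sumr big1 // => j _; have := P0 j; rewrite negbK => /eqP.
  by rewrite sumP -scalemxAr mulmx1 scalemx_eq0 pnatr_eq0.
exists j; have /submxP[w Uw] : (U <= U *m P j)%MS.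
  apply: U_min => // [h hH|].
    rewrite (_ : U *m P j *m rG h = U *m rG h *m P j) ?submxMr ?U_stable //.
    rewrite !mulmx_sumr mulmx_suml; apply: eq_bigr => m _.
    by rewrite -!scalemxAr -scalemxAl cHm.
  rewrite mulmx_sumr summx_sub // => m _; rewrite -scalemxAr scalemx_sub //.
  by rewrite stab ?groupX.
by rewrite {1}Uw -!mulmxA Py -!scalemxAr -Uw.
Qed.

(** Under a scalar action [U] is a line, and any nonzero vector [u] on it works: the transform of a
    nonzero multiple never vanishes, hence [d = 0], and its value at [1] gives the modulus of the
    multiple. *)
Lemma scalar_window (H : {group gT}) (U : 'M[C]_n) (z : C) :
  simple_on rG H U -> p.-primitive_root z ->
  (forall h, h \in H -> exists j : 'I_p, U *m rG h = z ^+ j *: U) ->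
  exists xi, good_window rG p H U 0 xi.
Proof.
move=> [U0 U_stable U_min] z_prim scal; set u := nz_row U.
have u0 : u != 0 by rewrite nz_row_eq0.
have uU : (u <= U)%MS by apply: nz_row_sub.
have uE h : h \in H -> exists j : 'I_p, u *m rG h = z ^+ j *: u.
  move=> /scal[j Uj]; exists j; case/submxP: uU => w ->.
  by rewrite -mulmxA Uj -scalemxAr.
have Uu : (U <= u)%MS.
  rewrite -(genmxE u); apply: U_min; rewrite ?genmxE //; last first.
    by rewrite -mxrank_eq0 genmxE mxrank_eq0.
  move=> h hH; rewrite genmxE (eqmxMr _ (genmxE u)).
  by have [j ->] := uE _ hH; rewrite scalemx_sub.
have uu : dotmx u u != 0 by rewrite dnorm_eq0.
have lin f : (f <= U)%MS -> exists a, f = a *: u.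
  by move=> fU; apply/sub_rVP; apply: submx_trans fU Uu.
have zn0 j : z ^+ j != 0 by rewrite expf_neq0 // (primitive_root_neq0 z_prim).
exists u; split=> // [f fU f0|_ f g /lin[a ->] /lin[b ->] eq_ab].
  rewrite mul0n leqn0 muln_eq0 /= cards_eq0; apply/eqP/setP=> h; rewrite !inE.
  apply/negP=> /andP[hH]; have [j uj] := uE _ hH; have [a fa] := lin _ fU.
  rewrite /coef_transform uj dotmxZr fa dotmxZl !mulf_eq0 conjC_eq0 (negPf (zn0 _)).
  by rewrite (negPf uu) orbF /= => a0; move: f0; rewrite fa (eqP a0) scale0r eqxx.
have {eq_ab} := eq_ab 1%g (group1 H).
rewrite /coef_transform repr_mx1 mulmx1 !dotmxZl !normrM => /(mulIf _) ab.
have {}ab : `|a| = `|b| by apply: ab; rewrite normr_eq0.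
have [b0|b0] := eqVneq b 0.
  exists 1; rewrite normr1; split=> //; rewrite scale1r; congr (_ *: _).
  by move: ab; rewrite b0 normr0 => /eqP; rewrite normr_eq0 => /eqP.
exists (a / b); rewrite normrM normfV ab divff ?normr_eq0 //; split=> //.
by rewrite scalerA divfK.
Qed.

Lemma good_window_exists (H : {group gT}) (U : 'M[C]_n) :
  H \subset G -> simple_on rG H U ->
  exists d xi, (p ^ d <= \rank U)%N /\ good_window rG p H U d xi.
Proof.
have [z z_prim] := prime_primitive_root_exists C p_prime.
move: {2}_.+1 (ltnSn #|H|) => N; elim: N H U => // N IHN H U leN sHG U_simple.
have [U0 U_stable U_min] := U_simple.
pose S := [set h | [exists j : 'I_p, U *m rG h == z ^+ j *: U]].
have SP h : h \in S -> exists j : 'I_p, U *m rG h = z ^+ j *: U.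
  by rewrite inE => /existsP[j /eqP Uj]; exists j.
have [/subsetP HS|HS] := boolP (H \subset S).
  have [|xi xi_good] := scalar_window U_simple z_prim; first by move=> h /HS /SP.
  by exists 0%N, xi; rewrite lt0n mxrank_eq0.
have nilH : nilpotent H := pgroup_nil (pgroupS sHG pG).
have S1 : 1%g \in S.
  by rewrite inE; apply/existsP; exists ord0; rewrite repr_mx1 mulmx1 scale1r.
have [y] := lower_central_escape nilH S1 HS; rewrite inE => /andP[yS yH] yc.
have HG h : h \in H -> h \in G by apply: (subsetP sHG).
have comm_H h : h \in H -> exists j : 'I_p, commutes_up_to rG U y h (z ^+ j).
  move=> hH; have [j Uj] := SP _ (yc h hH); exists j.
  have [hG yG] := (HG _ hH, HG _ yH); have yhG := groupM yG hG.
  have cG : [~ h, y]%g \in G by rewrite groupR.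
  rewrite /commutes_up_to -mulmxA -repr_mxM // commgC.
  rewrite (repr_mxM rG yhG cG) (repr_mxM rG yG hG) !mulmxA.
  have /submxP[w Uw] : (U *m rG y *m rG h <= U)%MS.
    by apply: submx_trans (submxMr _ (U_stable _ yH)) (U_stable _ hH).
  by rewrite {1}Uw -(mulmxA w) Uj -scalemxAr -Uw.
have [x xH xy] : exists2 x, x \in H & U *m rG x *m rG y != U *m rG y *m rG x.
  apply/exists_inP; apply: contraR yS; rewrite negb_exists_in => /forall_inP cy.
  have [|j Uj] := schur_scalar sHG U_simple yH z_prim.
    by move=> h /cy; rewrite negbK => /eqP.
  by rewrite inE; apply/existsP; exists j; rewrite Uj.
(* For [p = 2] every element is its own inverse, so [H] would be abelian, contrary to [xy]. *)
have p_odd : odd p.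
  have [p2|//] := even_prime p_prime; case/eqP: xy.
  have sq h : h \in H -> (h^-1 = h)%g.
    by move=> /HG /Gp hp; apply: (mulgI h); rewrite mulgV -hp p2 expgS expg1.
  rewrite -!mulmxA -!repr_mxM ?HG //; congr (_ *m rG _).
  by rewrite -[(x * y)%g]sq ?groupM // invMg !sq.
have [j0 comm_x] := comm_H x xH.
have j0_gt0 : (0 < j0)%N.
  rewrite lt0n; apply: contraNneq xy => j00.
  by move: comm_x; rewrite /commutes_up_to j00 scale1r => ->.
(* As [z ^+ j0] is again primitive, it replaces [z], so that [x] itself commutes with [y] up to the
   chosen root. *)
have zx_prim : p.-primitive_root (z ^+ j0).
  rewrite prim_root_exp_coprime // coprime_sym prime_coprime //.
  by rewrite gtnNdvd.
have {}comm_H h : h \in H -> exists j : 'I_p, commutes_up_to rG U y h ((z ^+ j0) ^+ j).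
  move=> /comm_H[j cj]; have [|k zk] := prim_rootP zx_prim (x := z ^+ j).
    by rewrite exprAC (prim_expr_order z_prim) expr1n.
  by exists k; rewrite -zk.
have xp := Gp (HG _ xH); have yp := Gp (HG _ yH).
have V_simple := V0_simple sHG U_simple xH yH yp zx_prim comm_x comm_H.
have KH : commuting_group y sHG U_simple \proper H.
  apply/properP; split; first by apply/subsetP=> h; apply: commuting_sub.
  by exists x => //; apply: (x_notin_commuting p_prime _ _ xH yH zx_prim comm_x).
have [||d [xi [rank_d xi_good]]] := IHN _ _ _ _ V_simple.
- exact: leq_trans (proper_card KH) _.
- exact: subset_trans (proper_sub KH) sHG.
(* The lower bound [p] on [t] is what the dominance of the largest overlap requires. *)
have [t pt t_generic] := card_gabor_zeros_lt zx_prim p.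
exists d.+1, (induced_window rG q x xi t); split.
  rewrite expnS; apply: leq_trans (rank_V0 sHG U_simple xH yH yp zx_prim comm_x).
  by rewrite leq_mul2l.
split.
- exact: (induced_window_sub xH yH t xi_good).
- move=> f fU f0.
  exact: (induced_window_zeros rG_unitary xH yH xp yp zx_prim comm_x comm_H
    xi_good t_generic).
- move=> d_small.
  exact: (induced_window_retrieves rG_unitary p_odd xH yH xp yp zx_prim comm_x
    xi_good pt).
Qed.

End WindowExists.

(** * The degree bound and the conclusion *)

(** Over an algebraically closed field the enveloping algebra is the full matrix algebra, of
    dimension [n ^ 2], and [#|G|] matrices span it. *)
Lemma irr_degree_sq_le (C : closedFieldType) (gT : finGroupType) (G : {group gT})
    (n : nat) (rG : mx_representation C G n) :
  mx_irreducible rG -> (n ^ 2 <= #|G|)%N.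
Proof.
move=> /group_closure_closed_field /andP[_ /eqP rk]; rewrite -mulnn -rk.
exact: rank_leq_row.
Qed.

Theorem corollary34 (R : realType) (p : nat) (gT : finGroupType)
    (G : {group gT}) (p_prime : prime p) (G_pgroup : (p.-group G)%g)
    (G_nontrivial : (1 < #|G|)%N) (G_exponent : exponent G = p)
    (G_order : #|G|%:R <= powR (p%:R : R) (2 + p%:R / 2))
    (n : nat) (rG : mx_representation R[i]%C G n)
    (rG_unitary : unitary_repr rG) (rG_irr : mx_irreducible rG) :
  does_phase_retrieval rG.
Proof.
have Gp x : x \in G -> (x ^+ p)%g = 1%g.
  by move=> xG; rewrite -G_exponent expg_exponent.
case: p => [//|q] in p_prime G_pgroup G_exponent G_order Gp *.
have G_simple : simple_on rG G 1%:M.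
  have [_ U0 U_min] := rG_irr; split=> // [h hG|W W_stable W1 W0].
    exact: submx1.
  by apply: U_min => //; apply/mxmoduleP.
have [d [xi [rank_d [_ _ retr]]]] :=
  good_window_exists rG_unitary p_prime G_pgroup Gp (subxx G) G_simple.
exists xi => f g eq_fg; apply: retr => //; rewrite ?submx1 //.
rewrite mxrank1 in rank_d; have n2 := irr_degree_sq_le rG_irr.
have pd : (q.+1 ^ (d * 2) <= #|G|)%N.
  by rewrite expnM; apply: leq_trans n2; rewrite leq_sqr.
have p_gt1 : 1 < q.+1%:R :> R by rewrite ltr1n prime_gt1.
(* The bounds on [#|G|] compare two powers of [p]; taking logarithms compares the exponents. *)
have le_exp : (d * 2)%:R <= 2 + q.+1%:R / 2 :> R.
  rewrite leNgt; apply/negP=> lt_exp.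
  have : (q.+1 ^ (d * 2))%:R <= powR (q.+1%:R : R) (2 + q.+1%:R / 2).
    by apply: le_trans G_order; rewrite ler_nat.
  have p_gt0 : 0 < q.+1%:R :> R by rewrite ltr0n.
  rewrite natrX -powR_mulrn ?ler0n // -ler_ln ?posrE ?powR_gt0 // !ln_powR.
  by rewrite ler_pM2r ?ln_gt0 // leNgt lt_exp.
(* Hence [2 * d.-1] is at most half of [p], well within the range where the window retrieves. *)
have : (4 * d <= 4 + q.+1)%N.
  rewrite -(ler_nat R) natrD natrM; rewrite natrM in le_exp; lra.
lia.
Qed.
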